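(* Let $d\ge1$ be an integer, let $X$ be Haar-distributed on $SO(n)$, and let $F_T$ be a polynomial function in the entries of $X\in SO(n)$ of degree at most $d$, represented as $F_T(g)=\langle T,\rho(g)\rangle_{\mathrm{HS}}$ with $T=\bigoplus_{k=0}^d T_k\in\mathrm{End}(\mathcal{U})$, $T_k\in\mathrm{End}((\mathbb{R}^n)^{\otimes k})$. Then $$\mathrm{Var}(F_T(X))\ge\frac{1}{(d+1)n^d}\,\|T^\sharp\|_{\mathrm{HS}}^2.$$
   Context: $\mathcal{U}:=\bigoplus_{k=0}^d(\mathbb{R}^n)^{\otimes k}$ with its standard inner product, and $\rho(g):=\bigoplus_{k=0}^d g^{\otimes k}\in\mathrm{End}(\mathcal{U})$ for $g\in SO(n)$. $\langle\cdot,\cdot\rangle_{\mathrm{HS}}$ and $\|\cdot\|_{\mathrm{HS}}$ denote the Hilbert–Schmidt (Frobenius) inner product and norm on $\mathrm{End}(\mathcal{U})$. The representation $F_T(g)=\langle T,\rho(g)\rangle_{\mathrm{HS}}$ is obtained by choosing a polynomial representative $\sum_{k=0}^d f_k$ with $f_k$ homogeneous of degree $k$ in the matrix entries and writing $f_k(g)=\langle T_k,g^{\otimes k}\rangle_{\mathrm{HS}}$. With $\mu$ the Haar probability measure on $SO(n)$, $\mathcal{C}_{\le d}:=\{S\in\mathrm{End}(\mathcal{U}):\langle S,\rho(g)\rangle_{\mathrm{HS}}\text{ is constant }\mu\text{-a.s.}\}$, and $T^\sharp$ is the orthogonal projection of $T$ onto $\mathcal{C}_{\le d}^\perp$ with respect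 to $\langle\cdot,\cdot\rangle_{\mathrm{HS}}$. *)

(* Defs.v *)
From HB Require Import structures.
From mathcomp Require Import all_boot all_order all_algebra.
From mathcomp Require Import mxtens.
From mathcomp Require Import all_classical all_reals all_analysis.

Set Implicit Arguments.
Unset Strict Implicit.
Unset Printing Implicit Defensive.

Import Order.TTheory GRing.Theory Num.Theory.
Import numFieldNormedType.Exports.

Local Open Scope classical_set_scope.
Local Open Scope ring_scope.

Definition special_orthogonal (R : realType) (n : nat) : set 'M[R]_n :=
  [set g | g^T *m g = 1%:M /\ \det g = 1].

(* The topology is the subspace topology of the n x n real matrices. *)
Definition SO (R : realType) (n : nat) : Type :=
  set_type (@special_orthogonal R n).

HB.instance Definition _ R n :=
  Choice.copy (SO R n) (set_type (@special_orthogonal R n)).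
HB.instance Definition _ R n :=
  Topological.copy (SO R n) (set_type (@special_orthogonal R n)).

Section SO_group.
Variables (R : realType) (n : nat).
Implicit Types g h : SO R n.

Definition SO_mx g : 'M[R]_n := val g.

Lemma SO_mxP g : special_orthogonal (SO_mx g).
Proof. exact: set_valP. Qed.

Lemma SO_mx_inj : injective SO_mx.
Proof. exact: val_inj. Qed.

Lemma SO_one_subproof : special_orthogonal (1%:M : 'M[R]_n).
Proof. by split; rewrite ?det1// trmx1 mulmx1. Qed.

Lemma SO_mul_subproof g h : special_orthogonal (SO_mx g *m SO_mx h).
Proof.
have [og dg] := SO_mxP g; have [oh dh] := SO_mxP h; split.
  by rewrite trmx_mul -mulmxA (mulmxA (SO_mx g)^T) og mul1mx.
by rewrite det_mulmx dg dh mulr1.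
Qed.

Lemma SO_inv_subproof g : special_orthogonal (SO_mx g)^T.
Proof.
have [og dg] := SO_mxP g; split; last by rewrite det_tr.
by rewrite trmxK; exact: mulmx1C.
Qed.

Definition SO_one : SO R n := SigSub (mem_set SO_one_subproof).
Definition SO_mul g h : SO R n := SigSub (mem_set (SO_mul_subproof g h)).
Definition SO_inv g : SO R n := SigSub (mem_set (SO_inv_subproof g)).

Lemma SO_mulA : associative SO_mul.
Proof. by move=> g h k; apply: SO_mx_inj; exact: mulmxA. Qed.

Lemma SO_mul1 : left_id SO_one SO_mul.
Proof. by move=> g; apply: SO_mx_inj; exact: mul1mx. Qed.

Lemma SO_mulr1 : right_id SO_one SO_mul.
Proof. by move=> g; apply: SO_mx_inj; exact: mulmx1. Qed.

Lemma SO_mulV : left_inverse SO_one SO_inv SO_mul.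
Proof. by move=> g; apply: SO_mx_inj; have [] := SO_mxP g. Qed.

Lemma SO_mulrV : right_inverse SO_one SO_inv SO_mul.
Proof.
by move=> g; apply: SO_mx_inj; apply: mulmx1C; have [] := SO_mxP g.
Qed.

HB.instance Definition _ := isGroup.Build (SO R n)
  SO_mulA SO_mul1 SO_mulr1 SO_mulV SO_mulrV.
HB.instance Definition _ := isPointed.Build (SO R n) SO_one.

End SO_group.

Definition SO_borel (R : realType) (n : nat) :=
  g_sigma_algebraType (@open (SO R n)).

Definition haar (R : realType) (n : nat) (mu : probability (SO_borel R n) R) :=
  forall (g : SO R n) (A : set (SO_borel R n)), measurable A ->
    mu [set (g * h)%g | h in A] = mu A.

Definition haar_distributed (dO : measure_display) (O : measurableType dO)
    (R : realType) (n : nat) (P : probability O R)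
    (mu : probability (SO_borel R n) R) (X : {RV P >-> SO_borel R n}) :=
  haar mu /\ forall A, measurable A -> distribution P X A = mu A.

(* Dimension of the direct sum of the k-fold tensor powers of R^n, 0 <= k <= d;
   the k-th summand has the n ^ k product basis vectors as its standard basis. *)
Definition dimU (n d : nat) : nat := (\sum_(k < d.+1) n ^ k)%N.

Section HilbertSchmidt.
Variables (R : realType) (N : nat).
Implicit Types (S T Z : 'M[R]_N) (C W : set 'M[R]_N).

Definition hs S T : R := \tr (S^T *m T).

Definition hs_norm T : R := Num.sqrt (hs T T).

Definition hs_orth C : set 'M[R]_N := [set S | forall Z, C Z -> hs S Z = 0].

(* For a linear subspace W the defining property has exactly one solution (see
   orth_projP and orth_proj_uniq), so the default value 0 is irrelevant. *)
Definition orth_proj W T : 'M[R]_N :=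
  xget 0 [set Q | W Q /\ hs_orth W (T - Q)].

Lemma hsE S T : hs S T = \sum_i \sum_j S i j * T i j.
Proof.
rewrite /hs /mxtrace exchange_big /=; apply: eq_bigr => i _.
by rewrite mxE; apply: eq_bigr => j _; rewrite mxE.
Qed.

Lemma hsC S T : hs S T = hs T S.
Proof. by rewrite /hs -mxtrace_tr trmx_mul trmxK. Qed.

Lemma hsDl S T Z : hs (S + T) Z = hs S Z + hs T Z.
Proof. by rewrite /hs linearD/= mulmxDl linearD. Qed.

Lemma hsZl a S T : hs (a *: S) T = a * hs S T.
Proof. by rewrite /hs linearZ/= -scalemxAl linearZ. Qed.

Lemma hs0l T : hs 0 T = 0.
Proof. by rewrite -(scale0r 0) hsZl mul0r. Qed.

Lemma hsBl S T Z : hs (S - T) Z = hs S Z - hs T Z.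
Proof. by rewrite -scaleN1r hsDl hsZl mulN1r. Qed.

Lemma hs_suml (I : Type) (r : seq I) (F : I -> 'M[R]_N) Z :
  hs (\sum_(i <- r) F i) Z = \sum_(i <- r) hs (F i) Z.
Proof.
by elim/big_rec2: _ => [|i x y _ <-]; rewrite ?hs0l ?hsDl.
Qed.

Lemma hs_eq0 T : hs T T = 0 -> T = 0.
Proof.
have sq_ge0 i j : 0 <= T i j * T i j by rewrite -expr2 sqr_ge0.
rewrite hsE => /eqP; rewrite psumr_eq0; last first.
  by move=> i _; apply: sumr_ge0 => j _; exact: sq_ge0.
move=> /allP T0; apply/matrixP => i j; rewrite mxE.
have /= := T0 i (mem_index_enum _); rewrite psumr_eq0 // => /allP.
by move=> /(_ j (mem_index_enum _)) /=; rewrite mulf_eq0 orbb => /eqP.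
Qed.

Lemma hs_orth_lin C a S T :
  hs_orth C S -> hs_orth C T -> hs_orth C (a *: S + T).
Proof. by move=> CS CT Z CZ; rewrite hsDl hsZl CS// CT// mulr0 addr0. Qed.

Lemma hs_orth0 C : hs_orth C 0.
Proof. by move=> Z _; exact: hs0l. Qed.

Lemma orth_proj_uniq W T Q Q' :
  (forall a S Z, W S -> W Z -> W (a *: S + Z)) ->
  W Q -> hs_orth W (T - Q) -> W Q' -> hs_orth W (T - Q') -> Q = Q'.
Proof.
move=> Wlin WQ oQ WQ' oQ'; apply/eqP; rewrite -subr_eq0; apply/eqP/hs_eq0.
have WD : W (Q - Q') by rewrite -scaleN1r addrC; exact: Wlin.
have -> : hs (Q - Q') (Q - Q') = hs (T - Q') (Q - Q') - hs (T - Q) (Q - Q').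
  by rewrite -hsBl opprB (addrC (T - Q')) addrA subrK.
by rewrite oQ// oQ'// subr0.
Qed.

Let ogs W (s : seq 'M[R]_N) :=
  [/\ forall x, x \in s -> W x, 0 \notin s &
   pairwise (fun x y => hs x y == 0) s].

Let P (s : seq 'M[R]_N) T := \sum_(e <- s) (hs T e / hs e e) *: e.

Let hsP W s T e : ogs W s -> e \in s -> hs (P s T) e = hs T e.
Proof.
case=> _; rewrite /P; elim: s => // x s IHs /=.
rewrite inE negb_or => /andP[x0 s0] /andP[/allP xs ps].
rewrite big_cons hsDl hsZl inE => /predU1P[->|es]; last first.
  by rewrite (eqP (xs _ es)) mulr0 add0r IHs.
rewrite divfK; last by apply: contra x0 => /eqP/hs_eq0 ->.
rewrite hs_suml big_seq big1 ?addr0// => y ys.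
by rewrite hsZl (hsC y x) (eqP (xs _ ys)) mulr0.
Qed.

Let ogs_free W s : ogs W s -> free s.
Proof.
case=> _; elim: s => [|x s IHs] /=; first by rewrite nil_free.
rewrite inE negb_or => /andP[x0 s0] /andP[/allP xs ps].
rewrite free_cons IHs// andbT; apply: contra x0 => xsp; apply/eqP.
apply/esym/hs_eq0.
rewrite {1}(@coord_span _ _ _ (in_tuple s) x xsp) hs_suml big1// => i _.
by rewrite hsZl (hsC _ x) (eqP (xs _ _)) ?mulr0// mem_nth.
Qed.

Lemma orth_projP W T : W 0 ->
  (forall a S Z, W S -> W Z -> W (a *: S + Z)) ->
  W (orth_proj W T) /\ hs_orth W (T - orth_proj W T).
Proof.
move=> W0 Wlin; apply: (@xgetPex _ _ [set Q | W Q /\ hs_orth W (T - Q)]).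
have WP s Z : ogs W s -> W (P s Z).
  case=> Ws _ _; rewrite /P big_seq; elim/big_ind: _ => //.
    by move=> x y Wx Wy; rewrite -(scale1r x); exact: Wlin.
  by move=> e /Ws We; rewrite -[X in W X]addr0; exact: Wlin.
have [s [os smax]] : exists s, ogs W s /\ forall Z, W Z -> Z = P s Z.
  apply: contrapT => nex.
  have big k : exists s, ogs W s /\ size s = k.
    elim: k => [|k [s [os sk]]]; first by exists [::].
    have [Z [WZ ZP]] : exists Z, W Z /\ Z <> P s Z.
      apply: contrapT => nZ; apply: nex; exists s; split=> // Z WZ.
      by apply: contrapT => ZP; apply: nZ; exists Z.
    exists (Z - P s Z :: s); rewrite /= sk; split=> //; case: (os) => Ws s0 ps.
    split=> /=.
    - move=> x; rewrite inE => /predU1P[->|/Ws//].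
      by rewrite -scaleN1r addrC; apply: Wlin => //; exact: WP.
    - by rewrite inE negb_or s0 eq_sym subr_eq0 andbT; exact/eqP.
    - rewrite ps andbT; apply/allP => e es.
      by rewrite hsBl (hsP _ os es) subrr.
  have [s [/ogs_free + sk]] := big (\dim {: 'M[R]_N}).+1.
  rewrite /free sk => /eqP dims.
  by have := dimvS (subvf (span s)); rewrite dims ltnn.
exists (P s T); split; first exact: WP.
move=> Z /smax ->; rewrite hsC hs_suml big_seq big1// => e es.
by rewrite hsZl (hsC e) hsBl (hsP _ os es) subrr mulr0.
Qed.

End HilbertSchmidt.

Section representation.
Variables (R : realType) (n d : nat).

Definition rho (g : 'M[R]_n) : 'M[R]_(dimU n d) := \mxdiag_(k < d.+1) (g ^t k).

Definition matrix_coef (T : 'M[R]_(dimU n d)) (g : SO R n) : R :=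
  hs T (rho (SO_mx g)).

Definition const_coefs (mu : probability (SO_borel R n) R) :
    set 'M[R]_(dimU n d) :=
  [set S | exists c : R, {ae mu, forall g, matrix_coef S g = c}].

Definition sharp (mu : probability (SO_borel R n) R) (T : 'M[R]_(dimU n d)) :=
  orth_proj (hs_orth (const_coefs mu)) T.

End representation.

(* Main.v *)
From HB Require Import structures.
Require Import Defs.
From mathcomp Require Import all_boot all_order all_algebra.
From mathcomp Require Import mxtens.
From mathcomp Require Import all_classical all_reals all_analysis.
From mathcomp Require Import measurable_realfun.
From mathcomp Require Import ring lra.

(** Let [C] be the space of constant coefficient functions and [V] its
orthogonal complement.  By Haar invariance [E rho] lies in [C], so the functions
[<S, rho>] with [S] in [V] have mean zero, and it suffices to prove that
[|S|^2 <= N * E <S, rho>^2] on [V], where [N = dim U <= (d+1) n^d].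
Let [k] be the least eigenvalue of the form [E <S, rho>^2] on [V], [W] its
eigenspace, [m = dim W], [P] the orthogonal projection onto [W], [p = P 1].
As [W] is stable under left multiplication by [rho g], [P (rho g) = rho g * p],
so that [E |P rho|^2] equals both [k m] and [|p|^2].  Moreover [w = w p] for
[w] in [W], which bounds [m], the sum of [|e p|^2] over an orthonormal basis of
[W], by [N |p|^2].  Hence [m <= N k m], that is [k >= 1 / N]. *)

Set Implicit Arguments.
Unset Strict Implicit.
Unset Printing Implicit Defensive.

Import Order.TTheory GRing.Theory Num.Theory.
Import numFieldNormedType.Exports.

Local Open Scope classical_set_scope.
Local Open Scope ring_scope.

(** * Orthogonal projections for the Hilbert-Schmidt inner product *)

Section HilbertSchmidtTheory.
Variables (R : realType) (N : nat).
Implicit Types (S T Z X : 'M[R]_N) (q : 'I_N * 'I_N).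

Definition mx_unit q : 'M[R]_N := delta_mx q.1 q.2.

Definition linear_set (W : set 'M[R]_N) :=
  W 0 /\ forall a S Z, W S -> W Z -> W (a *: S + Z).

Lemma hs_pairE S T : hs S T = \sum_q S q.1 q.2 * T q.1 q.2.
Proof. by rewrite hsE pair_bigA. Qed.

Lemma hsDr S T Z : hs S (T + Z) = hs S T + hs S Z.
Proof. by rewrite hsC hsDl !(hsC S). Qed.

Lemma hsZr a S T : hs S (a *: T) = a * hs S T.
Proof. by rewrite hsC hsZl (hsC S). Qed.

Lemma hsBr S T Z : hs S (T - Z) = hs S T - hs S Z.
Proof. by rewrite hsC hsBl !(hsC S). Qed.

Lemma hs_ge0 S : 0 <= hs S S.
Proof. by rewrite hs_pairE; apply: sumr_ge0 => q _; rewrite -expr2 sqr_ge0. Qed.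

Lemma hs_mx_unit S q : hs S (mx_unit q) = S q.1 q.2.
Proof.
rewrite hs_pairE (bigD1 q)//= mxE !eqxx mulr1 big1 ?addr0// => -[i j] /= ne.
rewrite mxE; case: q ne => a b /=; rewrite xpair_eqE.
by case: eqP; case: eqP; rewrite //= mulr0.
Qed.

Lemma mx_unit_sum S : S = \sum_q S q.1 q.2 *: mx_unit q.
Proof. by rewrite {1}[S]matrix_sum_delta pair_bigA. Qed.

Lemma hs_mull Z S T : hs (Z *m S) T = hs S (Z^T *m T).
Proof. by rewrite /hs trmx_mul mulmxA. Qed.

Lemma hs_mulr Z S T : hs (S *m Z) T = hs S (T *m Z^T).
Proof. by rewrite /hs trmx_mul -mulmxA mxtrace_mulC mulmxA. Qed.

(** Multiplying [Z] on the left by the matrix unit at [(i, j)] moves row [j] of [Z] to row [i] and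
    kills the rest, so each row is counted once for each of the [N] values of [i]. *)
Lemma sum_hs_unit_mulr Z :
  \sum_q hs (mx_unit q *m Z) (mx_unit q *m Z) = N%:R * hs Z Z.
Proof.
transitivity (\sum_(q : 'I_N * 'I_N) (Z *m Z^T) q.2 q.2).
  apply: eq_bigr => q _; rewrite hs_mulr -mulmxA hsC hs_mx_unit.
  rewrite mxE (bigD1 q.2)//= mxE !eqxx mul1r big1 ?addr0// => k kq.
  by rewrite mxE (negPf kq) andbF mul0r.
rewrite -(pair_bigA _ (fun _ j => (Z *m Z^T) j j)) /= sumr_const card_ord.
by rewrite mulr_natl -/(mxtrace _) mxtrace_mulC.
Qed.

Lemma hs_orth_linear C : linear_set (hs_orth C).
Proof. by split; [exact: hs_orth0 | exact: hs_orth_lin]. Qed.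

Section projection.
Variables (W : set 'M[R]_N) (Wlin : linear_set W).
Local Notation P := (orth_proj W).

Lemma orth_proj_in T : W (P T).
Proof. by have [] := orth_projP T Wlin.1 Wlin.2. Qed.

Lemma orth_proj_orth T : hs_orth W (T - P T).
Proof. by have [] := orth_projP T Wlin.1 Wlin.2. Qed.

Lemma orth_proj_eq T Q : W Q -> hs_orth W (T - Q) -> P T = Q.
Proof.
apply: orth_proj_uniq Wlin.2 _ _; first exact: orth_proj_in.
exact: orth_proj_orth.
Qed.

Lemma orth_proj_id T : W T -> P T = T.
Proof.
by move=> WT; apply: orth_proj_eq => //; rewrite subrr; exact: hs_orth0.
Qed.

Lemma hs_orth_projl S T : W T -> hs (P S) T = hs S T.
Proof.
by move=> WT; apply/esym/eqP; rewrite -subr_eq0 -hsBl orth_proj_orth.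
Qed.

Lemma orth_proj_adj S T : hs (P S) T = hs S (P T).
Proof.
rewrite -(hs_orth_projl S (orth_proj_in T)) !(hsC (P S)).
by rewrite (hs_orth_projl T (orth_proj_in S)).
Qed.

Lemma orth_proj_le S : hs (P S) (P S) <= hs S S.
Proof.
have := hs_ge0 (S - P S); rewrite hsBl !hsBr (hsC (P S) S).
by rewrite -(hs_orth_projl S (orth_proj_in S)); lra.
Qed.

(** Parseval in the basis of matrix units, once self-adjointness has moved [P] onto [X]. *)
Lemma sum_hs_proj_unit X :
  \sum_q hs (P (mx_unit q)) X ^+ 2 = hs (P X) (P X).
Proof.
rewrite [RHS]hs_pairE; apply: eq_bigr => q _.
by rewrite orth_proj_adj hsC hs_mx_unit.
Qed.

(* The left-hand side is the dimension of W. *)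
Lemma sum_proj_unit_le p : (forall S, W S -> S *m p = S) ->
  \sum_q hs (P (mx_unit q)) (P (mx_unit q)) <= N%:R * hs p p.
Proof.
move=> Wp.
have -> : hs p p = hs p^T p^T by rewrite /hs trmxK mxtrace_mulC.
rewrite -sum_hs_unit_mulr.
(* The maps [S |-> P S *m p] and [S |-> P (S *m p^T)] are adjoint, hence have the same
   Hilbert-Schmidt norm; the first one is [P] itself by [Wp]. *)
have -> : \sum_q hs (P (mx_unit q)) (P (mx_unit q)) =
    \sum_r hs (P (mx_unit r *m p^T)) (P (mx_unit r *m p^T)).
  under [RHS]eq_bigr => r _ do rewrite -sum_hs_proj_unit.
  rewrite [RHS]exchange_big; apply: eq_bigr => q _ /=.
  rewrite -{1 2}(Wp _ (orth_proj_in (mx_unit q))) hs_pairE.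
  by apply: eq_bigr => r _; rewrite -hs_mulr hs_mx_unit.
by apply: ler_sum => r _; exact: orth_proj_le.
Qed.

End projection.

(** The difference between [S] and its projection onto [C] is orthogonal both to [S] and to that
    projection, hence to itself. *)
Lemma hs_orthK C : linear_set C -> hs_orth (hs_orth C) `<=` C.
Proof.
move=> Clin S SCC.
have SP : hs_orth C (S - orth_proj C S) by exact: orth_proj_orth.
suff /eqP : S - orth_proj C S = 0.
  by rewrite subr_eq0 => /eqP ->; exact: orth_proj_in.
apply: hs_eq0; rewrite hsBl SCC// sub0r hsC SP ?oppr0//.
exact: orth_proj_in.
Qed.

End HilbertSchmidtTheory.

(** * Minimum of a quadratic form on the unit sphere of a space of matrices *)

Section Rayleigh.
Variables (R : realType) (N : nat).
Implicit Types (S T Z X : 'M[R]_N).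

(** Matrices are flattened to row vectors, where Heine-Borel and the extreme value theorem are
    applied. *)
Definition mx_of_rV (v : 'rV[R]_#|{: 'I_N * 'I_N}|) : 'M[R]_N :=
  \matrix_(i, j) v 0 (enum_rank (i, j)).

Lemma sum_continuous (T : topologicalType) (I : finType) (f : I -> T -> R) :
  (forall i, continuous (f i)) -> continuous (fun x => \sum_i f i x).
Proof.
move=> cf x; apply: cvg_big => // [|i _]; last exact: cf.
exact: add_continuous.
Qed.

Lemma mul_continuous_fun (T : topologicalType) (f g : T -> R) :
  continuous f -> continuous g -> continuous (fun x => f x * g x).
Proof. by move=> cf cg x; apply: cvgM; [exact: cf | exact: cg]. Qed.

Variables (V : set 'M[R]_N) (Vlin : linear_set V) (B : 'M[R]_N -> 'M[R]_N -> R).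
Hypothesis BC : forall S T, B S T = B T S.
Hypothesis Bl : forall a S T Z, B (a *: S + T) Z = a * B S Z + B T Z.

Let Br a S T Z : B Z (a *: S + T) = a * B Z S + B Z T.
Proof. by rewrite BC Bl !(BC _ Z). Qed.

Let B0 Z : B 0 Z = 0.
Proof. by have := Bl 1 0 0 Z; rewrite scaler0 add0r mul1r; lra. Qed.

Let BZ a S Z : B (a *: S) Z = a * B S Z.
Proof. by rewrite -[a *: S]addr0 Bl B0 addr0. Qed.

Let B_sum (I : finType) (c : I -> R) (F : I -> 'M[R]_N) Z :
  B (\sum_i c i *: F i) Z = \sum_i c i * B (F i) Z.
Proof.
by elim/big_rec2: _ => [|i x y _ <-]; [exact: B0 | exact: Bl].
Qed.

Let BE S T : B S T = \sum_p \sum_q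
  S p.1 p.2 * (T q.1 q.2 * B (mx_unit R p) (mx_unit R q)).
Proof.
rewrite {1}[S]mx_unit_sum B_sum; apply: eq_bigr => p _.
rewrite -mulr_sumr {1}[T]mx_unit_sum BC B_sum.
by under [in RHS]eq_bigr do rewrite BC.
Qed.

(** The continuous form attains its minimum on the compact unit sphere of [V]; both sides of the
    inequality are homogeneous of degree 2, so it extends to all of [V]. *)
Lemma quadratic_min : (exists2 S, V S & S <> 0) ->
  exists S0, [/\ V S0, hs S0 S0 = 1 &
    forall S, V S -> B S0 S0 * hs S S <= B S S].
Proof.
move=> [S1 VS1 S1n0].
have n1 : 0 < hs S1 S1.
  by rewrite lt_def hs_ge0 andbT; apply/eqP => /hs_eq0.
have normed S : 0 < hs S S ->
    hs ((Num.sqrt (hs S S))^-1 *: S) ((Num.sqrt (hs S S))^-1 *: S) = 1.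
  move=> S0; rewrite hsZl hsZr mulrA -invfM -expr2 sqr_sqrtr ?mulVf ?gt_eqF//.
  exact: ltW.
have VZ a S : V S -> V (a *: S).
  by move=> VS; rewrite -[_ *: _]addr0; apply: Vlin.2 => //; exact: Vlin.1.
pose A := [set v | hs (mx_of_rV v) (mx_of_rV v) = 1 /\ V (mx_of_rV v)].
pose rV_of_mx S : 'rV[R]_#|{: 'I_N * 'I_N}| :=
  \row_k S (enum_val k).1 (enum_val k).2.
have mxK S : mx_of_rV (rV_of_mx S) = S.
  by apply/matrixP => i j; rewrite !mxE enum_rankK.
have cont_q q : continuous (fun v => mx_of_rV v q.1 q.2).
  rewrite /mx_of_rV; under eq_fun do rewrite mxE; exact: coord_continuous.
have cont_form (F : 'I_N * 'I_N -> 'I_N * 'I_N -> R) : continuous (fun v =>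
    \sum_p \sum_q mx_of_rV v p.1 p.2 * (mx_of_rV v q.1 q.2 * F p q)).
  apply: sum_continuous => p; apply: sum_continuous => q.
  apply: mul_continuous_fun; first exact: cont_q.
  by apply: mul_continuous_fun; [exact: cont_q | exact: cst_continuous].
have cont_hs S : continuous (fun v => hs (mx_of_rV v) S).
  under eq_fun do rewrite hs_pairE.
  apply: sum_continuous => p; apply: mul_continuous_fun; first exact: cont_q.
  exact: cst_continuous.
have cont_nm : continuous (fun v => hs (mx_of_rV v) (mx_of_rV v)).
  under eq_fun do rewrite hs_pairE.
  by apply: sum_continuous => p; apply: mul_continuous_fun; exact: cont_q.
have closedA : closed A.
  (* Being its own double complement, [V] is cut out by linear equations and is therefore closed. *)
  have -> : A = (fun v => hs (mx_of_rV v) (mx_of_rV v)) @^-1` [set 1] `&`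
      \bigcap_(S in hs_orth V) ((fun v => hs (mx_of_rV v) S) @^-1` [set 0]).
    apply/seteqP; split => v /= [v1 vV]; split => //.
      by move=> S /= SV; rewrite hsC SV.
    apply: (hs_orthK Vlin) => S SV; exact: vV.
  apply: closedI.
    by apply: preimage_closed; [move=> v _; exact: cont_nm | exact: closed_eq].
  apply: closed_bigI => S _.
  by apply: preimage_closed; [move=> v _; exact: cont_hs | exact: closed_eq].
have boundA : bounded_set A.
  exists 1; split => // M M1 v [v1 _] /=.
  (* The norm is the largest absolute value of an entry, and the square of each entry is a summand
     of [hs], which is 1 here. *)
  rewrite [`|v|]mx_normrE (bigmax_le _ _)//=.
    by rewrite (le_trans ler01)// ltW.
  move=> [i k] _ /=; rewrite (ord1 i); apply: le_trans (ltW M1).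
  rewrite -(@ler_pXn2r _ 2)// ?nnegrE// expr1n -v1 hs_pairE -normrX.
  rewrite ger0_norm ?sqr_ge0//.
  rewrite (bigD1 (enum_val k))//= mxE -surjective_pairing enum_valK -expr2.
  rewrite lerDl; apply: sumr_ge0 => q _; rewrite -expr2; exact: sqr_ge0.
have compA := bounded_closed_compact boundA closedA.
have A0 : A !=set0.
  exists (rV_of_mx ((Num.sqrt (hs S1 S1))^-1 *: S1)); rewrite /A /= mxK.
  by split; [exact: normed | exact: VZ].
have contB : {within A, continuous (fun v => B (mx_of_rV v) (mx_of_rV v))}.
  apply: continuous_subspaceT.
  under eq_fun do rewrite BE.
  exact: cont_form.
have [c] := EVT_min_rV A0 compA contB.
rewrite inE => -[c1 cV] cmin; exists (mx_of_rV c); split => // S VS.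
have [->|/eqP S0] := eqVneq S 0.
  by rewrite hs0l mulr0 B0.
have nS : 0 < hs S S.
  by rewrite lt_def hs_ge0 andbT; apply/eqP => /hs_eq0.
have := cmin (rV_of_mx ((Num.sqrt (hs S S))^-1 *: S)).
rewrite !mxK inE /A /= mxK => /(_ (conj (normed _ nS) (VZ _ _ VS))).
rewrite BZ BC BZ mulrA -invfM -expr2 sqr_sqrtr ?(ltW nS)//.
by rewrite ler_pdivlMl// mulrC.
Qed.

(** The first variation [D] of the form at a minimiser, in any direction [Z] of [V], must vanish. *)
Lemma quadratic_min_eigen : (exists2 S, V S & S <> 0) ->
  exists S0, [/\ V S0, S0 <> 0 &
    exists k, (forall S, V S -> k * hs S S <= B S S) /\
      forall Z, V Z -> B S0 Z = k * hs S0 Z].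
Proof.
move=> /quadratic_min[S0 [VS0 n0 min0]]; exists S0; split => //.
  by move=> S00; move: n0; rewrite S00 hs0l => /eqP; rewrite eq_sym oner_eq0.
exists (B S0 S0); split => // Z VZ.
pose D := B S0 Z - B S0 S0 * hs S0 Z.
pose c := B Z Z - B S0 S0 * hs Z Z.
have quad t : 0 <= 2 * t * D + t ^+ 2 * c.
  have := min0 _ (Vlin.2 t _ _ VZ VS0).
  rewrite Bl !Br hsDl !hsDr !hsZl !hsZr n0 (BC Z S0) (hsC Z S0) /D /c.
  by move=> h; nra.
have c0 : 0 <= c by rewrite /c subr_ge0 min0.
apply/eqP; rewrite -subr_eq0 -/D; apply: contrapT => /negP D0.
(* The vertex [- D / c] makes no sense when [c = 0]; with [c + 1] as denominator the value is still
   negative unless [D = 0]. *)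
have := quad (- D / (c + 1)).
have -> : 2 * (- D / (c + 1)) * D + (- D / (c + 1)) ^+ 2 * c =
   - (D ^+ 2 * (c + 2) / (c + 1) ^+ 2).
  by field; rewrite gt_eqF// ltr_wpDl.
have D2 : 0 < D ^+ 2 by rewrite exprn_even_gt0.
rewrite oppr_ge0 leNgt divr_gt0//.
  by rewrite mulr_gt0//; lra.
by rewrite exprn_gt0//; lra.
Qed.

End Rayleigh.

(** * Means of bounded measurable functions *)

Section BoundedMeasurable.
Context {dT : measure_display} {T : measurableType dT} {R : realType}.
Implicit Types f g : T -> R.

(** Unlike integrability, this property is stable under products, and over a probability measure it
    implies integrability. *)
Definition bounded_mfun f :=
  measurable_fun setT f /\ exists M, forall x, `|f x| <= M.

Lemma bounded_mfun_cst c : bounded_mfun (fun=> c).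
Proof. by split; [exact: measurable_cst | exists `|c|]. Qed.

Lemma bounded_mfunD f g : bounded_mfun f -> bounded_mfun g ->
  bounded_mfun (fun x => f x + g x).
Proof.
move=> [mf [M fM]] [mg [K gK]]; split; first exact: measurable_funD.
by exists (M + K) => x; rewrite (le_trans (ler_normD _ _))// lerD.
Qed.

Lemma bounded_mfunM f g : bounded_mfun f -> bounded_mfun g ->
  bounded_mfun (fun x => f x * g x).
Proof.
move=> [mf [M fM]] [mg [K gK]]; split; first exact: measurable_funM.
by exists (M * K) => x; rewrite normrM ler_pM.
Qed.

Lemma bounded_mfun_sum (I : Type) (r : seq I) (F : I -> T -> R) :
  (forall i, bounded_mfun (F i)) -> bounded_mfun (fun x => \sum_(i <- r) F i x).
Proof.
move=> bF; elim: r => [|i r IH].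
  by under eq_fun do rewrite big_nil; exact: bounded_mfun_cst.
by under eq_fun do rewrite big_cons; exact: bounded_mfunD.
Qed.

Variable mu : probability T R.

Lemma bounded_mfun_integrable f : bounded_mfun f ->
  mu.-integrable setT (EFin \o f).
Proof.
move=> [mf [M fM]]; apply: measurable_bounded_integrable => //.
  by rewrite [X in (X < _)%E]probability_setT ltry.
exists M; split; first exact: num_real.
by move=> x Mx y _ /=; apply: le_trans (fM y) (ltW Mx).
Qed.

Definition mean f : R := \int[mu]_x f x.

Lemma mean_cst c : mean (fun=> c) = c.
Proof.
by rewrite /mean Rintegral_cst// [X in fine X]probability_setT mulr1.
Qed.

Lemma meanD f g : bounded_mfun f -> bounded_mfun g ->
  mean (fun x => f x + g x) = mean f + mean g.
Proof.
by move=> bf bg; apply: RintegralD => //; exact: bounded_mfun_integrable.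
Qed.

Lemma meanZ c f : bounded_mfun f -> mean (fun x => c * f x) = c * mean f.
Proof.
by move=> bf; apply: RintegralZl => //; exact: bounded_mfun_integrable.
Qed.

Lemma mean_sum (I : Type) (r : seq I) (F : I -> T -> R) :
  (forall i, bounded_mfun (F i)) ->
  mean (fun x => \sum_(i <- r) F i x) = \sum_(i <- r) mean (F i).
Proof.
move=> bF; elim: r => [|i r IH].
  rewrite big_nil -[RHS]mean_cst; congr mean.
  by apply/funext => x; rewrite big_nil.
rewrite big_cons -IH -meanD//; last exact: bounded_mfun_sum.
by congr mean; apply/funext => x; rewrite big_cons.
Qed.

Lemma mean_EFin f : bounded_mfun f -> (\int[mu]_x (f x)%:E = (mean f)%:E)%E.
Proof.
move=> bf; rewrite /mean /Rintegral fineK//.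
by apply: integrable_fin_num => //; exact: bounded_mfun_integrable.
Qed.

Lemma ae_mono (Q1 Q2 : T -> Prop) : (forall x, Q1 x -> Q2 x) ->
  {ae mu, forall x, Q1 x} -> {ae mu, forall x, Q2 x}.
Proof. exact: filterS. Qed.

Lemma ae_mono2 (Q1 Q2 Q3 : T -> Prop) : (forall x, Q1 x -> Q2 x -> Q3 x) ->
  {ae mu, forall x, Q1 x} -> {ae mu, forall x, Q2 x} ->
  {ae mu, forall x, Q3 x}.
Proof. exact: filterS2. Qed.

Lemma mean_ae f g : bounded_mfun f -> bounded_mfun g ->
  {ae mu, forall x, f x = g x} -> mean f = mean g.
Proof.
move=> [mf _] [mg _] fg; congr fine; apply: ae_eq_integral => //.
- exact/measurable_EFinP.
- exact/measurable_EFinP.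
- by apply: filterS fg => x -> _.
Qed.

End BoundedMeasurable.

(** Serves twice: with [phi] a left translation it gives invariance of the mean, and with [phi] the
    random variable it carries the variance to the group. *)
Lemma mean_transfer d1 d2 (T1 : measurableType d1) (T2 : measurableType d2)
    (R : realType) (mu : probability T1 R) (nu : probability T2 R)
    (phi : T1 -> T2) (f : T2 -> R) :
  measurable_fun setT phi ->
  (forall A, measurable A -> mu (phi @^-1` A) = nu A) ->
  bounded_mfun f -> mean mu (f \o phi) = mean nu f.
Proof.
move=> mphi phiE bf; congr fine.
have bfphi : bounded_mfun (f \o phi).
  case: bf => mf [M fM]; split; first exact: measurableT_comp.
  by exists M => x; exact: fM.
pose phi' : {mfun T1 >-> T2} :=
  HB.pack phi (isMeasurableFun.Build _ _ _ _ phi mphi).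
rewrite [RHS](eq_measure_integral (pushforward mu phi')); last first.
  by move=> A mA _; exact/esym/phiE.
rewrite (@integral_pushforward _ _ _ _ _ phi' mphi mu setT (EFin \o f))//.
- by apply/measurable_EFinP; case: bf.
- exact: (bounded_mfun_integrable mu bfphi).
Qed.

(** * Multiplicativity and transposes of tensor powers and of [rho] *)

Section tensor_powers.
Variable R : comNzRingType.

Lemma tensmx1 m n : (1%:M : 'M[R]_m) *t (1%:M : 'M[R]_n) = 1%:M.
Proof.
apply/matrixP => i j; rewrite !mxE -natrM mulnb; congr (_%:R).
rewrite -[in RHS](inj_eq (can_inj (@mxtens_unindexK m n))).
by rewrite -xpair_eqE -!surjective_pairing.
Qed.

Lemma ntensmx_mul n k (A B : 'M[R]_n) : (A *m B) ^t k = A ^t k *m B ^t k.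
Proof.
case: k => [|k]; first by rewrite !ntensmx0 mulmx1.
elim: k => [|k IH]; first by rewrite !ntensmx1.
by rewrite !ntensmxSS IH tensmx_mul.
Qed.

Lemma ntensmx_tr n k (A : 'M[R]_n) : A^T ^t k = (A ^t k)^T.
Proof.
case: k => [|k]; first by rewrite !ntensmx0 trmx1.
elim: k => [|k IH]; first by rewrite !ntensmx1.
by rewrite !ntensmxSS IH trmx_tens.
Qed.

Lemma ntensmx_id n k : (1%:M : 'M[R]_n) ^t k = 1%:M.
Proof.
case: k => [|k]; first by rewrite ntensmx0.
elim: k => [|k IH]; first by rewrite ntensmx1.
by rewrite ntensmxSS IH tensmx1.
Qed.

End tensor_powers.

Section rho_theory.
Variables (R : realType) (n d : nat).
Local Notation rho := (@rho R n d).

Lemma rhoM g h : rho (g *m h) = rho g *m rho h.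
Proof.
rewrite /Defs.rho {3}/mxdiag mul_mxdiag_mxblock; apply/eq_mxblock => i j.
by case: eqVneq => [->|]; rewrite ?conform_mx_id ?ntensmx_mul ?mulmx0.
Qed.

Lemma rho1 : rho 1%:M = 1%:M.
Proof. by rewrite -mxdiagZ; apply: eq_mxdiag => k; exact: ntensmx_id. Qed.

Lemma rho_tr g : rho g^T = (rho g)^T.
Proof. by rewrite tr_mxdiag; apply: eq_mxdiag => k; exact: ntensmx_tr. Qed.

End rho_theory.

(** * Measurability and left translations on the special orthogonal group *)

Section SO_integration.
Variables (R : realType) (n d : nat).
Implicit Types g h : SO R n.
Local Notation rho g := (@rho R n d (SO_mx g)).

Lemma SO_mxM g h : SO_mx (g * h)%g = SO_mx g *m SO_mx h.
Proof. by []. Qed.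

Lemma SO_mxV g : SO_mx (g^-1)%g = (SO_mx g)^T.
Proof. by []. Qed.

Lemma trmx_rho_mul g : (rho g)^T *m rho g = 1%:M.
Proof. by rewrite -rho_tr -rhoM; have [-> _] := SO_mxP g; exact: rho1. Qed.

Lemma SO_entry_continuous i j : continuous (fun g : SO R n => SO_mx g i j).
Proof.
move=> g; apply: (@continuous_comp _ _ _ (@SO_mx R n) (fun M => M i j)).
  exact: initial_continuous.
exact: coord_continuous.
Qed.

Lemma continuous_SO_measurable (f : SO R n -> R) : continuous f ->
  measurable_fun (setT : set (SO_borel R n)) f.
Proof.
move=> /continuousP cf; apply: (measurability _ (RGenOpens.measurableE R)).
move=> _ [_ [a [b ->] <-]]; rewrite setTI; apply: sub_sigma_algebra.
exact/cf/interval_open.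
Qed.

(** The columns of an orthogonal matrix are unit vectors. *)
Lemma SO_entry_le g i j : `|SO_mx g i j| <= 1.
Proof.
have [og _] := SO_mxP g.
have /matrixP/(_ j j) := og; rewrite !mxE eqxx (bigD1 i)//= !mxE => gj.
rewrite -(@ler_pXn2r _ 2)// ?nnegrE// expr1n -normrX ger0_norm ?sqr_ge0//.
rewrite -[leRHS]gj -expr2 lerDl; apply: sumr_ge0 => k _.
by rewrite mxE -expr2 sqr_ge0.
Qed.

Lemma SO_entry_bounded_mfun i j :
  bounded_mfun (fun g : SO_borel R n => SO_mx g i j).
Proof.
split; last by exists 1 => g; exact: SO_entry_le.
by apply: continuous_SO_measurable; exact: SO_entry_continuous.
Qed.

(** Each entry of [rho g] is either constant or a product of entries of [g]. *)
Lemma rho_entry_bounded_mfun i j :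
  bounded_mfun (fun g : SO_borel R n => rho g i j).
Proof.
rewrite /Defs.rho /mxdiag; under eq_fun do rewrite mxE.
(* An index splits into a block number and a position whose type depends on it; generalising all
   four lets equal block numbers be substituted. *)
move: (tagnat.sig1 i) (tagnat.sig1 j) (tagnat.sig2 i) (tagnat.sig2 j).
move=> {i j} k l.
case: eqVneq => [->|_] i j; last first.
  by under eq_fun do rewrite mxE; exact: bounded_mfun_cst.
under eq_fun do rewrite conform_mx_id.
case: l i j => -[|l] _ /= i j; first exact: bounded_mfun_cst.
elim: l i j => [|l IH] i j; first exact: SO_entry_bounded_mfun.
under eq_fun do rewrite ntensmxSS mxE.
by apply: bounded_mfunM; [exact: SO_entry_bounded_mfun | exact: IH].
Qed.

Lemma matrix_coef_bounded_mfun (T : 'M[R]_(dimU n d)) :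
  bounded_mfun (matrix_coef T : SO_borel R n -> R).
Proof.
rewrite /matrix_coef; under eq_fun do rewrite hs_pairE.
apply: bounded_mfun_sum => q; apply: bounded_mfunM.
  exact: bounded_mfun_cst.
exact: rho_entry_bounded_mfun.
Qed.

Lemma mx_continuous (X : topologicalType) (F : X -> 'M[R]_n) :
  (forall i j, continuous (fun x => F x i j)) -> continuous F.
Proof.
move=> cF x A [P FP PA].
have : \forall y \near x, forall i j, P i j (F y i j).
  by apply: filter_forall => i; apply: filter_forall => j; exact/cF/FP.
by apply: filterS => y Py; exact: PA.
Qed.

Lemma SO_mul_continuous g : continuous (fun h : SO R n => (g * h)%g : SO R n).
Proof.
apply: (@continuous_comp_initial _ _ _ (@SO_mx R n)).
apply: mx_continuous => i j /=.
under eq_fun do rewrite SO_mxM mxE.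
apply: sum_continuous => k; apply: mul_continuous_fun.
  exact: cst_continuous.
exact: SO_entry_continuous.
Qed.

Lemma SO_mul_measurable g : measurable_fun setT
  (fun h : SO_borel R n => (g * h)%g : SO_borel R n).
Proof.
apply: (@measurability _ _ (SO_borel R n) (SO_borel R n) _ _
  (@open (SO R n))) => //.
move=> _ [B oB <-]; rewrite setTI; apply: sub_sigma_algebra.
by move/continuousP: (@SO_mul_continuous g); exact.
Qed.

(** Bridges the images of sets in the definition of [haar] and the preimages that a change of
    variables requires. *)
Lemma SO_mul_preimage g (A : set (SO R n)) :
  (fun h => g * h)%g @^-1` A = [set (g^-1 * h)%g | h in A].
Proof.
apply/seteqP; split => [h Agh|_ [h Ah <-]] /=; last by rewrite mulVKg.
by exists (g * h)%g => //; rewrite mulKg.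
Qed.

Variables (mu : probability (SO_borel R n) R) (mu_haar : haar mu).

Lemma haar_preimage g (A : set (SO_borel R n)) : measurable A ->
  mu ((fun h : SO_borel R n => (g * h)%g : SO_borel R n) @^-1` A) = mu A.
Proof. by move=> mA; rewrite SO_mul_preimage; exact: mu_haar. Qed.

Lemma haar_mean g (f : SO_borel R n -> R) : bounded_mfun f ->
  mean mu (fun h => f (g * h)%g) = mean mu f.
Proof.
apply: mean_transfer; first exact: SO_mul_measurable.
exact: haar_preimage.
Qed.

Lemma haar_ae g (Q : SO_borel R n -> Prop) :
  {ae mu, forall h, Q h} -> {ae mu, forall h, Q (g * h)%g}.
Proof.
move=> [A [mA A0 QA]].
exists ((fun h : SO_borel R n => (g * h)%g : SO_borel R n) @^-1` A); split.
- by rewrite -[X in measurable X]setTI; exact: SO_mul_measurable.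
- by rewrite haar_preimage.
- by move=> h nQ; exact: QA.
Qed.

End SO_integration.

(** * The second-moment form of coefficient functions and its eigenspaces *)

Section matrix_coefficients.
Variables (R : realType) (n d : nat).
Variables (mu : probability (SO_borel R n) R) (mu_haar : haar mu).
Implicit Types (g h : SO R n) (S T Z : 'M[R]_(dimU n d)).
Local Notation rho g := (@rho R n d (SO_mx g)).
Local Notation C := (@const_coefs R n d mu).
Local Notation bm := matrix_coef_bounded_mfun.

Lemma matrix_coef_lin a S T g :
  matrix_coef (a *: S + T) g = a * matrix_coef S g + matrix_coef T g.
Proof. by rewrite /matrix_coef hsDl hsZl. Qed.

Lemma matrix_coef_mull g S h :
  matrix_coef ((rho g)^T *m S) h = matrix_coef S (g * h)%g.
Proof. by rewrite /matrix_coef hs_mull trmxK SO_mxM rhoM. Qed.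

Lemma const_coefs_linear : linear_set C.
Proof.
split=> [|a S T [b bS] [c cT]].
  by exists 0; apply: aeW => g; exact: hs0l.
exists (a * b + c); apply: ae_mono2 bS cT => g Sg Tg.
by rewrite matrix_coef_lin Sg Tg.
Qed.

Lemma const_coefs_mull g S : C S -> C ((rho g)^T *m S).
Proof.
move=> [c cS]; exists c; have := haar_ae mu_haar g cS.
by apply: ae_mono => h; rewrite matrix_coef_mull.
Qed.

(** The adjoint of left multiplication by [rho g] is left multiplication by its transpose, which
    preserves [C]. *)
Lemma orth_const_coefs_mull g S : hs_orth C S -> hs_orth C (rho g *m S).
Proof. by move=> CS Z CZ; rewrite hs_mull CS//; exact: const_coefs_mull. Qed.

Lemma trmx_rhoE g : (rho g)^T = rho (g^-1)%g.
Proof. by rewrite SO_mxV rho_tr. Qed.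

Definition mean_rho : 'M[R]_(dimU n d) :=
  \matrix_(i, j) mean mu (fun g => rho g i j).

Lemma mean_matrix_coef S : mean mu (matrix_coef S) = hs S mean_rho.
Proof.
rewrite hs_pairE /matrix_coef; under [in LHS]eq_fun do rewrite hs_pairE.
rewrite mean_sum => [|q].
  apply: eq_bigr => q _; rewrite mxE meanZ//; exact: rho_entry_bounded_mfun.
apply: bounded_mfunM; first exact: bounded_mfun_cst.
exact: rho_entry_bounded_mfun.
Qed.

(** Pairing [mean_rho] with [rho g] gives the mean over [h] of the trace of [rho (g^-1 * h)], which
    by invariance does not depend on [g]. *)
Lemma const_coefs_mean_rho : C mean_rho.
Proof.
exists (mean mu (matrix_coef (1%:M : 'M[R]_(dimU n d)))); apply: aeW => g.
rewrite [LHS]hsC -mean_matrix_coef -[RHS](haar_mean mu_haar (g^-1)%g);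
  last exact: bm.
congr mean; apply/funext => h; rewrite -matrix_coef_mull mulmx1.
by rewrite -trmx_rhoE trmxK.
Qed.

Lemma mean_orth_const_coefs S : hs_orth C S -> mean mu (matrix_coef S) = 0.
Proof. by rewrite mean_matrix_coef; apply; exact: const_coefs_mean_rho. Qed.

Definition coef_form S T :=
  mean mu (fun g => matrix_coef S g * matrix_coef T g).

Lemma coef_formC S T : coef_form S T = coef_form T S.
Proof. by congr mean; apply/funext => g; rewrite mulrC. Qed.

Lemma coef_form_lin a S T Z :
  coef_form (a *: S + T) Z = a * coef_form S Z + coef_form T Z.
Proof.
have bST U : bounded_mfun (fun g : SO_borel R n =>
    matrix_coef U g * matrix_coef Z g).
  by apply: bounded_mfunM; exact: bm.
rewrite /coef_form -meanZ// -meanD//; last first.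
  by apply: bounded_mfunM => //; exact: bounded_mfun_cst.
by congr mean; apply/funext => g; rewrite matrix_coef_lin mulrDl mulrA.
Qed.

(** Substitute [g * h] for [h] and use that [rho g] is orthogonal. This is what makes the
    eigenspaces of the form stable under left multiplication. *)
Lemma coef_form_mull g S T :
  coef_form (rho g *m S) T = coef_form S ((rho g)^T *m T).
Proof.
rewrite /coef_form -(haar_mean mu_haar g); last first.
  by apply: bounded_mfunM; exact: bm.
congr mean; apply/funext => h; rewrite -!matrix_coef_mull mulmxA trmx_rho_mul.
by rewrite mul1mx.
Qed.

Section eigenspace.
Variable k : R.
(** The eigenspace for [k] of the form compressed to the complement of [C], hence the test against
    [Z] in that complement only. *)
Let W := [set S | hs_orth C S /\
  forall Z, hs_orth C Z -> coef_form S Z = k * hs S Z].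
Local Notation P := (orth_proj W).
Local Notation p := (P 1%:M).

Lemma coef_eigenspace_linear : linear_set W.
Proof.
split=> [|a S T [CS kS] [CT kT]]; split; first exact: hs_orth0.
- move=> Z _; rewrite hs0l mulr0 /coef_form -[RHS](mean_cst mu).
  by congr mean; apply/funext => g; rewrite /matrix_coef hs0l mul0r.
- exact: hs_orth_lin.
- by move=> Z CZ; rewrite coef_form_lin kS// kT// hsDl hsZl; ring.
Qed.
Let Wlin := coef_eigenspace_linear.

Lemma coef_eigenspace_mull g S : W S -> W (rho g *m S).
Proof.
move=> [CS kS]; split; first exact: orth_const_coefs_mull.
move=> Z CZ; rewrite coef_form_mull kS ?hs_mull//.
by rewrite trmx_rhoE; exact: orth_const_coefs_mull.
Qed.

(** [W] is stable under [rho g] and under its transpose [rho (g^-1)], so [P] commutes with left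
    multiplication by [rho g]; evaluate at the identity. *)
Lemma proj_eigenspace_rho g : P (rho g) = rho g *m p.
Proof.
apply: (orth_proj_eq Wlin).
  by apply: coef_eigenspace_mull; exact: (orth_proj_in Wlin).
rewrite -{1}[rho g]mulmx1 -mulmxBr => Z WZ; rewrite hs_mull.
apply: (orth_proj_orth Wlin); rewrite trmx_rhoE; exact: coef_eigenspace_mull.
Qed.

(* S |-> P S - S p vanishes on all rho g, so its coordinate functionals are
   represented by elements of C, which are orthogonal to W. *)
Lemma eigenspace_mulr_proj S : W S -> S *m p = S.
Proof.
move=> WS; apply/matrixP => i j; apply/esym/eqP; rewrite -subr_eq0; apply/eqP.
pose E : 'M[R]_(dimU n d) := mx_unit R (i, j).
have DE T : hs (P E - E *m p^T) T = P T i j - (T *m p) i j.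
  rewrite hsBl (orth_proj_adj Wlin) hs_mulr trmxK.
  by rewrite !(hsC E) !hs_mx_unit.
have CD : C (P E - E *m p^T).
  exists 0; apply: aeW => g; rewrite /matrix_coef DE proj_eigenspace_rho.
  by rewrite subrr.
by rewrite -{1}(orth_proj_id Wlin WS) -DE hsC; case: WS => CS _; exact: CS.
Qed.

Lemma eigenvalue_ge : (exists2 S, W S & S <> 0) -> 1 <= k * (dimU n d)%:R.
Proof.
move=> [S WS S0].
pose m := \sum_q hs (P (mx_unit R q)) (P (mx_unit R q)).
have m_le : m <= (dimU n d)%:R * hs p p :=
  sum_proj_unit_le Wlin eigenspace_mulr_proj.
(* Each [P (mx_unit R q)] lies in [W], so its coefficient function has second moment [k] times its
   squared norm; and [rho g *m p] has the norm of [p] for every [g]. *)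
have mk : k * m = hs p p.
  transitivity (mean mu (fun g => hs (P (rho g)) (P (rho g)))).
    transitivity (mean mu (fun g => \sum_q matrix_coef (P (mx_unit R q)) g
        * matrix_coef (P (mx_unit R q)) g)); last first.
      congr mean; apply/funext => g; rewrite -(sum_hs_proj_unit Wlin).
      by apply: eq_bigr => q _; rewrite expr2.
    rewrite mean_sum => [|q]; last by apply: bounded_mfunM; exact: bm.
    rewrite mulr_sumr; apply: eq_bigr => q _.
    have [CP kP] := orth_proj_in Wlin (mx_unit R q).
    by rewrite -kP.
  rewrite -[RHS](mean_cst mu); congr mean; apply/funext => g.
  by rewrite proj_eigenspace_rho hs_mull mulmxA trmx_rho_mul mul1mx.
(* If [m] were 0, then [P] would kill all matrix units, hence also [S = P S]. *)
have m_gt0 : 0 < m.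
  rewrite lt_def sumr_ge0 ?andbT => [|q _]; last exact: hs_ge0.
  apply/eqP => m0; apply: S0; apply: hs_eq0.
  rewrite -{1 2}(orth_proj_id Wlin WS) -(sum_hs_proj_unit Wlin).
  rewrite big1// => q _; suff -> : P (mx_unit R q) = 0 by rewrite hs0l expr0n.
  apply: hs_eq0; move/eqP: m0.
  rewrite psumr_eq0 => [/allP|r _]; last exact: hs_ge0.
  by move=> /(_ q (mem_index_enum _))/eqP.
by rewrite -(ler_pM2r m_gt0) mul1r mulrAC mk mulrC.
Qed.

End eigenspace.

(** The least eigenvalue of the form is subject to [eigenvalue_ge]. The case [S = 0] is treated
    apart because the minimisation needs a nonzero complement. *)
Lemma coef_form_ge S : hs_orth C S -> hs S S <= (dimU n d)%:R * coef_form S S.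
Proof.
move=> CS; have [->|/eqP S0] := eqVneq S 0.
  rewrite hs0l mulr_ge0//; apply: Rintegral_ge0 => g _.
  by rewrite -expr2 sqr_ge0.
have [S1 [CS1 S10 [k [kmin kS1]]]] : exists S0, [/\ hs_orth C S0, S0 <> 0 &
    exists k, (forall S, hs_orth C S -> k * hs S S <= coef_form S S) /\
      forall Z, hs_orth C Z -> coef_form S0 Z = k * hs S0 Z].
  apply: quadratic_min_eigen; [exact: hs_orth_linear|exact: coef_formC|
    exact: coef_form_lin|by exists S].
have k1 : 1 <= k * (dimU n d)%:R by apply: eigenvalue_ge; exists S1.
apply: le_trans (ler_wpM2l _ (kmin _ CS)) => //.
by rewrite mulrA (mulrC _ k) ler_peMl// hs_ge0.
Qed.

(** Put [Q = sharp mu T]. As [T - Q] lies in the double complement of [C], the coefficients of [T]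
    and [Q] differ almost surely by a constant [b]. That of [Q] has mean zero, so the second moment
    about [c] is [coef_form Q Q + (b - c) ^+ 2]. *)
Lemma mean_sqr_matrix_coef_ge T c :
  coef_form (sharp mu T) (sharp mu T) <=
  mean mu (fun g => (matrix_coef T g - c) ^+ 2).
Proof.
have Vlin := hs_orth_linear C.
have CQ : hs_orth C (sharp mu T) := orth_proj_in Vlin T.
have [b bT] : C (T - sharp mu T).
  by apply: (hs_orthK const_coefs_linear); exact: (orth_proj_orth Vlin).
set Q := sharp mu T in CQ bT *.
have -> : mean mu (fun g => (matrix_coef T g - c) ^+ 2) =
    mean mu (fun g => matrix_coef Q g * matrix_coef Q g +
      ((b - c) *+ 2 * matrix_coef Q g + (b - c) ^+ 2)).
  apply: mean_ae.
  - under eq_fun do rewrite expr2.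
    by apply: bounded_mfunM; (apply: bounded_mfunD;
      [exact: bm|exact: bounded_mfun_cst]).
  - apply: bounded_mfunD; first by apply: bounded_mfunM; exact: bm.
    apply: bounded_mfunD; last exact: bounded_mfun_cst.
    by apply: bounded_mfunM; [exact: bounded_mfun_cst|exact: bm].
  apply: ae_mono bT => g; rewrite /matrix_coef hsBl => /eqP.
  by rewrite subr_eq => /eqP ->; ring.
rewrite meanD; last 2 first.
- by apply: bounded_mfunM; exact: bm.
- apply: bounded_mfunD; last exact: bounded_mfun_cst.
  by apply: bounded_mfunM; [exact: bounded_mfun_cst|exact: bm].
rewrite meanD; last 2 first.
- by apply: bounded_mfunM; [exact: bounded_mfun_cst|exact: bm].
- exact: bounded_mfun_cst.
rewrite meanZ; last exact: bm.
by rewrite mean_orth_const_coefs// mulr0 add0r mean_cst lerDl sqr_ge0.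
Qed.

End matrix_coefficients.

(** * Dimension count and passage to the variance of the random variable *)

Lemma dimU_le n d : (0 < n)%N -> (dimU n d <= d.+1 * n ^ d)%N.
Proof.
move=> n0; rewrite -[d.+1 in leqRHS]card_ord -sum_nat_const.
apply: leq_sum => k _.
(* Positivity of [n] matters at [k = 0]: the summand [n ^ 0] is 1, whereas [0 ^ d] is 0 for positive
   [d]. *)
by rewrite leq_pexp2l// -ltnS.
Qed.

Theorem corollaryD5 (R : realType) (n d : nat) (hn : (0 < n)%N) (hd : (1 <= d)%N)
    (mu : probability (SO_borel R n) R)
    (dO : measure_display) (O : measurableType dO) (P : probability O R)
    (X : {RV P >-> SO_borel R n}) (hX : haar_distributed mu X)
    (T_ : forall k : 'I_d.+1, 'M[R]_(n ^ k))
    (T : 'M[R]_(dimU n d)) (hT : T = \mxdiag_(k < d.+1) T_ k) :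
  ((((d.+1)%:R * n%:R ^+ d)^-1 * hs_norm (sharp mu T) ^+ 2)%:E
     <= 'V_P[fun w => matrix_coef T (X w)])%E.
Proof.
have [mu_haar XE] := hX.
(* Only the square is transported along the law of [X]. The centre stays the expectation over [O],
   since the lower bound holds for every centre [c]. *)
have -> : ('V_P[fun w => matrix_coef T (X w)] =
    (mean mu (fun g => (matrix_coef T g -
      fine 'E_P[fun w => matrix_coef T (X w)]) ^+ 2))%:E)%E.
  set c := fine _.
  have bf : bounded_mfun (fun g : SO_borel R n => (matrix_coef T g - c) ^+ 2).
    under eq_fun do rewrite expr2.
    by apply: bounded_mfunM; (apply: bounded_mfunD;
      [exact: matrix_coef_bounded_mfun|exact: bounded_mfun_cst]).
  rewrite -(mean_transfer (measurable_funP X) XE bf) -mean_EFin; last first.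
    case: bf => mf [M fM]; split; first exact: measurableT_comp.
    by exists M => x; exact: fM.
  rewrite /variance unlock unlock; apply: eq_integral => w _.
  by rewrite /= /c unlock expr2.
rewrite lee_fin; apply: le_trans (mean_sqr_matrix_coef_ge mu_haar T _).
have CQ : hs_orth (const_coefs mu) (sharp mu T).
  exact: orth_proj_in (hs_orth_linear _) T.
rewrite /hs_norm sqr_sqrtr ?hs_ge0// ler_pdivrMl; last first.
  by rewrite mulr_gt0 ?exprn_gt0// ltr0n.
apply: le_trans (coef_form_ge mu_haar CQ) _; apply: ler_wpM2r.
  by apply: Rintegral_ge0 => g _; rewrite -expr2 sqr_ge0.
by rewrite -natrX -natrM ler_nat dimU_le.
Qed.
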